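(* For every $1\leq p\leq\infty$, the $\ell^p$-isoperimetric profile is monotonous under regular maps between amenable groups: if $\Gamma$ and $\Lambda$ are finitely generated amenable groups and there exists a regular map $\Gamma\to\Lambda$, then $j_{p,\Gamma}\succcurlyeq j_{p,\Lambda}$.
   Context: Finitely generated groups are equipped with word metrics associated to finite symmetric generating sets. A map $f\colon\Gamma\to\Lambda$ between finitely generated groups is regular if it is Lipschitz and $\sup_{\lambda\in\Lambda}|f^{-1}(\{\lambda\})|<\infty$. For a finitely generated group $G$ with finite symmetric generating set $S_G$ and $f\colon G\to\mathbb R$ finitely supported, $\|\nabla^l_{S_G} f\|_p$ is the $\ell^p$-norm of the function $(s,g)\mapsto f(sg)-f(g)$ on $S_G\times G$ (so $\|\nabla^l_{S_G} f\|_p^p=\sum_{g\in G,s\in S_G}|f(sg)-f(g)|^p$ for $p<\infty$, and it is the supremum norm for $p=\infty$). The $\ell^p$-isoperimetric profile is $$j_{p,G}(n)=\sup\left\{\frac{\|f\|_p}{\|\nabla^l_{S_G} f\|_p}\colon f\neq 0,\ |\operatorname{supp} f|\le n\right\}$$ (the ratio is $+\infty$ if the gradient vanishes, which can only happen if $G$ is finite). For monotone functions, $g\succcurlyeq f$ means that there is a constant $C>0$ with $f(n)=O(g(Cn))$ as $n\to\infty$. *)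

(* Defs.v *)
From HB Require Import structures.
From mathcomp Require Import all_boot all_order all_algebra finmap.
From mathcomp Require Import all_classical all_reals all_analysis.

Set Implicit Arguments.
Unset Strict Implicit.
Unset Printing Implicit Defensive.
Import Order.TTheory GRing.Theory Num.Theory.
Import numFieldNormedType.Exports.

Local Open Scope classical_set_scope.
Local Open Scope ring_scope.

Definition spelled (G : groupType) (S : {fset G}) (g : G) (w : seq G) : Prop :=
  {subset w <= S} /\ (\big[*%g/1%g]_(x <- w) x)%g = g.

Record symGenSet (G : groupType) := SymGenSet {
  genset :> {fset G};
  genset_sym : forall s, s \in genset -> (s^-1)%g \in genset;
  genset_gen : forall g, exists w, spelled genset g w
}.

Section WordMetric.
Variables (G : groupType) (S : symGenSet G).

Lemma word_length_subproof (g : G) :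
  exists n, `[< exists2 w, spelled S g w & size w = n >].
Proof.
by have [w gw] := genset_gen S g; exists (size w); apply/asboolP; exists w.
Qed.

Definition word_length (g : G) : nat := ex_minn (word_length_subproof g).

Definition word_dist (g h : G) : nat := word_length (g^-1 * h)%g.

End WordMetric.

Definition regular (R : realType) (G L : groupType)
    (SG : symGenSet G) (SL : symGenSet L) (f : G -> L) : Prop :=
  (exists K : R, forall x y,
     (word_dist SL (f x) (f y))%:R <= K * (word_dist SG x y)%:R) /\
  (exists N : nat, forall l, (f @^-1` [set l] #<= `I_N)%card).

(* Only the values of [m] on bounded functions are constrained: [m] stands for
   a left-invariant mean on l^infinity(G). *)
Definition invariant_mean (R : realType) (G : groupType)
    (m : (G -> R) -> R) : Prop :=
  [/\ forall (a : R) (f g : G -> R), bounded_fun f -> bounded_fun g ->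
        m (fun x => a * f x + g x) = a * m f + m g,
      forall f : G -> R, bounded_fun f -> (forall x, 0 <= f x) -> 0 <= m f,
      m (fun=> 1) = 1 &
      forall (h : G) (f : G -> R), bounded_fun f ->
        m (fun x => f (h * x)%g) = m f].

Definition amenable (R : realType) (G : groupType) : Prop :=
  exists m : (G -> R) -> R, invariant_mean m.

(* The point [0] only matters when [D] is empty, where [ereal_sup] alone would
   give [-oo]. The value at [p = -oo] is junk. *)
Definition lpnorm (R : realType) (p : \bar R) (T : choiceType) (D : set T)
    (f : T -> R) : \bar R :=
  match p with
  | r%:E => poweR (\esum_(x in D) (`|f x| `^ r)%:E) r^-1
  | +oo%E => ereal_sup ([set 0%E] `|` [set `|f x|%:E | x in D])
  | -oo%E => 0%E
  end.

Definition supp (R : realType) (G : groupType) (f : G -> R) : set G :=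
  [set g | f g != 0].

Definition grad_norm (R : realType) (p : \bar R) (G : groupType)
    (S : {fset G}) (f : G -> R) : \bar R :=
  lpnorm p ([set` S] `*` [set: G])
    (fun sg : G * G => f (sg.1 * sg.2)%g - f sg.2).

(* The argument is real so that [profile p S (C * n)] makes sense for every real
   [C > 0]. In [\bar R] one has [0^-1 = +oo], so the ratio is [+oo] when the
   gradient vanishes. *)
Definition profile (R : realType) (p : \bar R) (G : groupType)
    (S : {fset G}) (x : R) : \bar R :=
  ereal_sup [set (lpnorm p [set: G] f / grad_norm p S f)%E | f in
    [set f : G -> R | [/\ f <> (fun=> 0), finite_set (supp f) &
                          (#|` fset_set (supp f)|)%:R <= x]]].

(* [dominates g f] is "f(n) = O(g(C n)) for some C > 0", for [\bar R]-valued
   functions nonnegative at infinity. *)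
Definition dominates (R : realType) (g f : R -> \bar R) : Prop :=
  exists2 C : R, 0 < C &
  exists2 K : R, 0 < K &
  \forall n \near \oo, (f n%:R <= K%:E * g (C * n%:R)%R)%E.

(* Main.v *)
(** Let [f : G -> L] be regular and put [u x = (f x^-1)^-1], so that [u (s * x)]
    is [u x] multiplied on the left by a word of bounded length.  Pull a test
    function [phi] on [L] back to the functions [psi_l x = phi (u x * l)] for
    [l] in [L]; each has support of size [O(|supp phi|)].  For [p = +oo] take
    [l = (u 1)^-1 * a] and let [a] vary.

    For finite [p], cut every [psi_l] along the connected components of its
    support in the Cayley graph.  Both [p]-th powers of norms are additive over
    components, and a component has diameter at most its size.  Average over
    [x], with an invariant mean of [G], the sum over [l] of the masses and
    energies of the component of [x] in [supp psi_l], each divided by the size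
    of the component.  Since components have bounded diameter, left invariance
    gives a mass transport principle: the averaged mass is exactly
    [||phi||_p^p], while the averaged energy is at most a constant times
    [||grad phi||_p^p].  An isoperimetric inequality for functions of bounded
    support on [G] therefore descends to [phi].  No Folner sets are needed. *)

Require Import Defs.
From mathcomp Require Import all_boot all_order all_algebra finmap.
From mathcomp Require Import all_classical all_reals all_analysis.
Import Order.TTheory GRing.Theory Num.Theory.

Set Implicit Arguments.
Unset Strict Implicit.
Unset Printing Implicit Defensive.
Import numFieldNormedType.Exports.

Local Open Scope classical_set_scope.
Local Open Scope ring_scope.

(** * Finite sums over index lists that agree on the support *)

Lemma eq_big_supp (V : nmodType) (I : eqType) (s1 s2 : seq I) (F : I -> V) :
  uniq s1 -> uniq s2 -> (forall i, F i != 0 -> (i \in s1) = (i \in s2)) ->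
  \sum_(i <- s1) F i = \sum_(i <- s2) F i.
Proof.
move=> u1 u2 s12.
have drop0 s : \sum_(i <- s) F i = \sum_(i <- [seq j <- s | F j != 0]) F i.
  rewrite big_filter [LHS](bigID (fun i => F i != 0))/=.
  by rewrite [X in _ + X]big1 ?addr0// => i /negPn/eqP.
rewrite (drop0 s1) (drop0 s2); apply: perm_big; apply: uniq_perm; rewrite ?filter_uniq//.
by move=> i; rewrite !mem_filter; case: eqVneq => //= /s12.
Qed.

(** * Invariant means and mass transport *)

Section Mean.
Variables (R : realType) (G : groupType) (m : (G -> R) -> R).
Hypothesis mP : invariant_mean m.
Implicit Types f g : G -> R.

Lemma bounded_funI (c : R) f : (forall x, `|f x| <= c) -> bounded_fun f.
Proof.
move=> fc; exists c; split; first exact: num_real.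
by move=> M cM x _; exact: le_trans (fc x) (ltW cM).
Qed.

Lemma bounded_funE f : bounded_fun f -> exists c, forall x, `|f x| <= c.
Proof.
case=> c [_ fc]; exists (c + 1) => x.
by apply: (fc (c + 1) _ x I); rewrite ltrDl.
Qed.

Lemma bounded_fun_sum (I : Type) (s : seq I) (F : I -> G -> R) :
  (forall i, bounded_fun (F i)) -> bounded_fun (fun x => \sum_(i <- s) F i x).
Proof.
move=> bF; have /choice[c cF] : forall i, exists c, forall x, `|F i x| <= c.
  by move=> i; exact: bounded_funE.
apply: (@bounded_funI (\sum_(i <- s) c i)) => x.
by apply: le_trans (ler_norm_sum _ _ _) _; apply: ler_sum => i _; exact: cF.
Qed.

Lemma bounded_fun_cst (c : R) : bounded_fun ((fun=> c) : G -> R).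
Proof. exact: (@bounded_funI `|c|). Qed.

Lemma mean_cst (c : R) : m (fun=> c) = c.
Proof.
case: mP => lin _ m1 _.
have b0 : bounded_fun ((fun=> 0) : G -> R) by exact: bounded_fun_cst.
have b1 : bounded_fun ((fun=> 1) : G -> R) by exact: bounded_fun_cst.
have m0 : m (fun=> 0) = 0.
  have := lin 1 _ _ b0 b0; rewrite [X in m X](_ : _ = fun=> 0); last first.
    by apply/funext => x; rewrite mul1r addr0.
  by rewrite mul1r => /eqP; rewrite -subr_eq subrr => /eqP.
have := lin c _ _ b1 b0; rewrite m1 m0 mulr1 addr0 => e.
by rewrite -[RHS]e; congr m; apply/funext => x; rewrite mulr1 addr0.
Qed.

Lemma meanD f g : bounded_fun f -> bounded_fun g ->
  m (fun x => f x + g x) = m f + m g.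
Proof.
case: mP => lin _ _ _ bf bg; have := lin 1 _ _ bf bg; rewrite mul1r => <-.
by congr m; apply/funext => x; rewrite mul1r.
Qed.

Lemma mean_sum (I : Type) (s : seq I) (F : I -> G -> R) :
  (forall i, bounded_fun (F i)) ->
  m (fun x => \sum_(i <- s) F i x) = \sum_(i <- s) m (F i).
Proof.
move=> bF; elim: s => [|i s IH].
  rewrite big_nil -[RHS]mean_cst; congr m.
  by apply/funext => x; rewrite big_nil.
rewrite big_cons -IH -meanD//; last exact: bounded_fun_sum.
by congr m; apply/funext => x; rewrite big_cons.
Qed.

Lemma meanZ (c : R) f : bounded_fun f -> m (fun x => c * f x) = c * m f.
Proof.
case: mP => lin _ _ _ bf; have := lin c _ _ bf (bounded_fun_cst 0).
by rewrite mean_cst addr0 => <-; congr m; apply/funext => x; rewrite addr0.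
Qed.

Lemma mean_le f g : bounded_fun f -> bounded_fun g ->
  (forall x, f x <= g x) -> m f <= m g.
Proof.
case: mP => lin pos _ _ bf bg fg; rewrite -subr_ge0.
have -> : m g - m f = m (fun x => -1 * f x + g x).
  by rewrite lin// mulN1r addrC.
have [cf fcf] := bounded_funE bf; have [cg gcg] := bounded_funE bg.
apply: pos => [|x]; last by rewrite mulN1r addrC subr_ge0.
apply: (@bounded_funI (cf + cg)) => x.
by rewrite mulN1r (le_trans (ler_normD _ _))// normrN lerD.
Qed.

(** For each displacement [h], left invariance allows the substitution of [h^-1 * y] for [x].
    Finiteness of [B] lets [m] pass through the sum, and the bound [c] makes every term a bounded
    function, the only kind on which [m] is controlled. *)
Lemma mass_transport (B : seq G) (c : R) (T : G -> G -> R) :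
  (forall x y, `|T x y| <= c) ->
  m (fun x => \sum_(h <- B) T x (h * x)%g) =
  m (fun y => \sum_(h <- B) T (h^-1 * y)%g y).
Proof.
move=> Tc; case: (mP) => _ _ _ inv.
rewrite !mean_sum; try by move=> h; apply: (@bounded_funI c).
apply: eq_bigr => h _; rewrite -[LHS](inv h^-1%g); last exact: (@bounded_funI c).
by congr m; apply/funext => x; rewrite mulVKg.
Qed.

End Mean.

(** * Connected components of finite subsets of the Cayley graph *)

Section Components.
Variables (G : groupType) (S : symGenSet G) (Z : {fset G}).

(** Edges are left multiplications, to match the gradient [f (s * g) - f g]. *)
Definition adjacent (a b : Z) : bool := (val b * (val a)^-1)%g \in genset S.

Definition component (x : G) : {fset G} :=
  [fset val b | b in [pred b : Z | [exists a, (val a == x) && connect adjacent a b]]]%fset.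

Lemma componentP x y :
  reflect (exists a b : Z, [/\ val a = x, val b = y & connect adjacent a b])
          (y \in component x).
Proof.
apply: (iffP idP).
  case/imfsetP => b /= /existsP[a /andP[/eqP ax ab]] ->.
  by exists a, b.
case=> a [b [ax <- ab]]; apply/imfsetP; exists b => //=.
by apply/existsP; exists a; rewrite ax eqxx.
Qed.

Lemma adjacent_sym : symmetric adjacent.
Proof.
move=> a b; by apply/idP/idP => /genset_sym; rewrite invgF.
Qed.

Lemma componentC x y : (y \in component x) = (x \in component y).
Proof.
have C := sym_connect_sym adjacent_sym.
by apply/componentP/componentP => -[a [b [? ? ab]]]; exists b, a; rewrite C.
Qed.

Lemma component_trans x y z : y \in component x -> z \in component y -> z \in component x.
Proof.
case/componentP => a [b [ax yb ab]] /componentP[b' [c [by' zc bc]]].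
apply/componentP; exists a, c; split=> //; apply: connect_trans bc.
by rewrite (_ : b' = b)//; apply: val_inj; rewrite by' yb.
Qed.

Lemma component_eq x y : y \in component x -> component y = component x.
Proof.
move=> yx; apply/fsetP => z; apply/idP/idP; apply: component_trans => //.
by rewrite componentC.
Qed.

Lemma component_refl x : x \in Z -> x \in component x.
Proof. by move=> xZ; apply/componentP; exists [` xZ]%fset, [` xZ]%fset. Qed.

Lemma component_sub x y : y \in component x -> y \in Z.
Proof. by case/componentP => a [b [_ <- _]]; exact: valP. Qed.

Lemma component_step x y s : y \in component x -> s \in genset S -> (s * y)%g \in Z ->
  (s * y)%g \in component x.
Proof.
move=> yx sS sZ; have yZ := component_sub yx; apply: (component_trans yx).
apply/componentP; exists [` yZ]%fset, [` sZ]%fset; split=> //; apply: connect1.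
by rewrite /adjacent /= mulgK.
Qed.

End Components.

Fixpoint word_ball (G : groupType) (S : {fset G}) (k : nat) : {fset G} :=
  if k is k'.+1 then
    (word_ball S k' `|` [fset (s * b)%g | s in S, b in word_ball S k'])%fset
  else [fset 1%g]%fset.

Lemma path_ball (G : groupType) (S : symGenSet G) (Z : {fset G}) (a : Z) p :
  path (@adjacent G S Z) a p -> (val (last a p) * (val a)^-1)%g \in word_ball S (size p).
Proof.
elim/last_ind: p => [_|p b IH]; first by rewrite /= mulgV in_fset1.
rewrite rcons_path last_rcons size_rcons => /andP[/IH bp e].
rewrite in_fsetU; apply/orP; right; apply/imfset2P.
exists (val b * (val (last a p))^-1)%g => //.
by exists (val (last a p) * (val a)^-1)%g => //; rewrite mulgA mulgVK.
Qed.

Lemma word_ball_le (G : groupType) (S : {fset G}) k l : (k <= l)%N ->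
  (word_ball S k `<=` word_ball S l)%fset.
Proof.
move/subnKC <-; elim: (l - k)%N => [|n IH]; first by rewrite addn0.
by rewrite addnS; apply: fsubset_trans IH _; rewrite /= fsubsetUl.
Qed.

(** A shortest connecting path has no repeated vertex, so its length is at most the size of [Z].
    Displacements inside components thus lie in one finite ball independent of [x], as mass
    transport requires. *)
Lemma component_ball (G : groupType) (S : symGenSet G) (Z : {fset G}) n x y :
  (#|` Z| <= n)%N -> y \in component S Z x -> (y * x^-1)%g \in word_ball S n.
Proof.
move=> Zn /componentP[a [b [<- <- /connectP[p ap ->]]]].
case: (shortenP ap) => q aq uq _; apply: (fsubsetP (word_ball_le S _) _ (path_ball aq)).
apply: leq_trans Zn; rewrite cardfE; apply: leq_trans (max_card (mem (a :: q))).
by rewrite (card_uniqP uq).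
Qed.

(** * Mass transport along components of level sets *)

Section ComponentTransport.
Variables (R : realType) (G L : groupType) (m : (G -> R) -> R).
Hypothesis mP : invariant_mean m.
Variables (S : symGenSet G) (u : G -> L) (A : {fset L}) (Z : L -> {fset G}).
Variable M : nat.
Hypothesis ZE : forall l x, (x \in Z l) = ((u x * l)%g \in A).
Hypothesis ZM : forall l, (#|` Z l| <= M)%N.

(** When [x] is outside [Z l] the component is empty and the value is 0. *)
Definition component_avg (e : L -> G -> R) (l : L) (x : G) : R :=
  #|` component S (Z l) x|%:R^-1 * \sum_(y <- component S (Z l) x) e l y.

(** Turns a sum over a set that varies with the base point into a sum over a fixed set of
    displacements, the form taken by [mass_transport]. *)
Lemma sum_ball_comp (t : G -> G) (K : {fset G}) (e : G -> R) : injective t ->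
  (forall y, y \in K -> exists2 h, h \in word_ball S M & t h = y) ->
  \sum_(h <- word_ball S M) (t h \in K)%:R * e (t h) = \sum_(y <- K) e y.
Proof.
move=> ti tK.
rewrite -(big_map t xpredT (fun y => (y \in K)%:R * e y)).
transitivity (\sum_(y <- K) (y \in K)%:R * e y); last first.
  by rewrite !big_seq; apply: eq_bigr => y ->; rewrite mul1r.
apply: eq_big_supp; rewrite ?map_inj_uniq ?fset_uniq// => y.
have [yK _|] := boolP (y \in K); last by rewrite mul0r eqxx.
by have [h hB <-] := tK _ yK; rewrite map_f.
Qed.

(* The sum over [a \in A] with [l = (u x)^-1 * a] is the sum over the [l] whose
   level set [Z l] contains [x]. *)
Lemma component_transport (e : L -> G -> R) (c : R) :
  (forall l y, `|e l y| <= c) ->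
  m (fun x => \sum_(a <- A) component_avg e ((u x)^-1 * a)%g x) =
  m (fun y => \sum_(a <- A) e ((u y)^-1 * a)%g y).
Proof.
move=> ec.
(* The share of [e l y] sent to [x]: each point of the component of [y] receives an equal part. *)
pose k l x y : R := (y \in component S (Z l) x)%:R / #|` component S (Z l) x|%:R * e l y.
pose T x y : R := \sum_(a <- A) k ((u x)^-1 * a)%g x y.
have kc l x y : `|k l x y| <= c.
  rewrite /k normrM; have c0 : 0 <= c := le_trans (normr_ge0 _) (ec l y).
  rewrite -[leRHS]mul1r; apply: ler_pM => //.
  have [|_] := boolP (_ \in _); last by rewrite mul0r normr0.
  move=> yK; rewrite mul1r normfV normr_nat invf_le1 ?ltr0n ?ler1n.
    by rewrite cardfs_gt0; apply/fset0Pn; exists y.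
  by rewrite cardfs_gt0; apply/fset0Pn; exists y.
have Tc x y : `|T x y| <= \sum_(a <- A) c.
  by apply: le_trans (ler_norm_sum _ _ _) _; apply: ler_sum => a _.
have componentZ l x y : y \in component S (Z l) x -> x \in Z l.
  by rewrite componentC; apply: component_sub.
(* A nonzero kernel puts [x] and [y] in the same component of [Z l], so [l] belongs to both families
   [(u x)^-1 * A] and [(u y)^-1 * A], and either one may index the sum. *)
have TE x y : T x y = \sum_(a <- A) k ((u y)^-1 * a)%g x y.
  rewrite /T -(big_map (fun a => (u x)^-1 * a)%g xpredT (fun l => k l x y)).
  rewrite -(big_map (fun a => (u y)^-1 * a)%g xpredT (fun l => k l x y)).
  have mem z l : l \in [seq ((u z)^-1 * a)%g | a <- A] = (z \in Z l).
    rewrite ZE; apply/mapP/idP => [[a aA ->]|]; first by rewrite mulVKg.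
    by move=> zA; exists (u z * l)%g; rewrite ?mulKg.
  apply: eq_big_supp; rewrite ?map_inj_uniq ?fset_uniq//; try exact: mulgI.
  move=> l; rewrite !mem /k; have [yx _|] := boolP (y \in component S (Z l) x).
    by rewrite (componentZ _ _ _ yx) (component_sub yx).
  by rewrite !mul0r eqxx.
rewrite [LHS](_ : _ = m (fun x => \sum_(h <- word_ball S M) T x (h * x)%g)); last first.
  congr m; apply/funext => x; rewrite exchange_big/=; apply: eq_bigr => a _.
  set l := (_ * a)%g; rewrite /component_avg -(@sum_ball_comp (fun h => h * x)%g).
  - by rewrite mulr_sumr; apply: eq_bigr => h _; rewrite /k mulrCA mulrA.
  - exact: mulIg.
  - by move=> y /(component_ball (ZM l)) yx; exists (y * x^-1)%g; rewrite ?mulgVK.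
rewrite (mass_transport mP _ Tc); congr m; apply/funext => y.
under eq_bigr do rewrite TE.
rewrite exchange_big/= big_seq [RHS]big_seq; apply: eq_bigr => a aA.
set l := (_ * a)%g; set K := component S (Z l) y.
have yK : y \in K by apply: component_refl; rewrite ZE mulVKg.
have K0 : #|` K|%:R != 0 :> R.
  by rewrite pnatr_eq0 cardfs_eq0; apply/fset0Pn; exists y.
(* All points of [K] have the same component [K], so the total sent out by [y] is [#|K|] equal
   shares of [e l y], that is [e l y] itself. *)
transitivity (\sum_(h <- word_ball S M) (h^-1 * y \in K)%g%:R * (#|` K|%:R^-1 * e l y)).
  apply: eq_bigr => h _; rewrite /k -mulrA componentC.
  have [hK|] := boolP (_ \in _); last by rewrite !mul0r.
  by rewrite (component_eq hK).
rewrite (@sum_ball_comp (fun h => h^-1 * y)%g K (fun=> #|` K|%:R^-1 * e l y)).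
- rewrite big_const_seq count_predT iter_addr_0 -mulrnAl.
  by rewrite -[_^-1 *+ _]mulr_natr mulVf ?mul1r.
- by move=> h h' /mulIg/invg_inj.
- move=> z; rewrite componentC => /(component_ball (ZM l)) zy.
  by exists (y * z^-1)%g; rewrite // invgF mulgVK.
Qed.

End ComponentTransport.

(** * Energies as r-th powers: translation by words and truncation *)

Section PowerEnergy.
Variables (R : realType) (r : R).
Hypothesis r1 : 1 <= r.

Definition energy (G : groupType) (S : {fset G}) (f : G -> R) : \bar R :=
  \esum_(sg in [set` S] `*` [set: G]) (`|f (sg.1 * sg.2)%g - f sg.2| `^ r)%:E.

Definition mass (T : choiceType) (f : T -> R) : \bar R :=
  \esum_(x in [set: T]) (`|f x| `^ r)%:E.

Let r0 : 0 <= r. Proof. exact: le_trans r1. Qed.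
Let rN0 : r != 0. Proof. by rewrite gt_eqF// (lt_le_trans _ r1). Qed.

Lemma powR_normD (x y : R) : `|x + y| `^ r <= 2 `^ r * (`|x| `^ r + `|y| `^ r).
Proof.
wlog xy : x y / `|x| <= `|y| => [H|].
  by have [/H//|/ltW/H] := leP `|x| `|y|; rewrite addrC [_ `^ r + _]addrC.
have h : `|x + y| <= 2 * `|y|.
  by rewrite mulr_natl mulr2n (le_trans (ler_normD _ _))// lerD2r.
apply: le_trans (ge0_ler_powR r0 _ _ h) _; rewrite ?nnegrE ?mulr_ge0//.
by rewrite powRM// ler_wpM2l ?powR_ge0// lerDr powR_ge0.
Qed.

Lemma sum_le_esum (T : choiceType) (D : set T) (F : T -> R) (s : seq T) :
  (forall x, 0 <= F x) -> uniq s -> (forall x, x \in s -> D x) ->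
  ((\sum_(x <- s) F x)%:E <= \esum_(x in D) (F x)%:E)%E.
Proof.
move=> F0 us sD; apply: esum_ge; exists [set` s].
  by split=> //; exact: finite_seq.
by rewrite -fsbig_seq// -sumEFin.
Qed.

Lemma esum_supp (T : choiceType) (F : T -> R) (A : {fset T}) :
  (forall x, 0 <= F x) -> (forall x, x \notin A -> F x = 0) ->
  (\esum_(x in [set: T]) (F x)%:E = (\sum_(x <- A) F x)%:E)%E.
Proof.
move=> F0 FA; transitivity (\esum_(x in [set` A]) (F x)%:E)%E.
  rewrite [RHS]esum_mkcond; apply: eq_esum => x _; case: ifPn => // xA.
  by rewrite FA//; apply: contra xA => ?; rewrite inE.
rewrite esum_fset//; last by move=> x _; rewrite lee_fin.
by rewrite -fsbig_seq ?fset_uniq// -sumEFin.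
Qed.

Section Translates.
Variables (L : groupType) (S : {fset L}) (f : L -> R) (D : R).
Hypothesis fD : (energy S f <= D%:E)%E.

Lemma translate_gen (s : L) (B : seq L) : s \in S -> uniq B ->
  \sum_(a <- B) `|f (s * a)%g - f a| `^ r <= D.
Proof.
move=> sS uB; rewrite -lee_fin; apply: le_trans fD.
rewrite -(big_map (fun a => (s, a)) xpredT
  (fun sg : L * L => `|f (sg.1 * sg.2)%g - f sg.2| `^ r)).
apply: sum_le_esum.
- by move=> ?; exact: powR_ge0.
- by rewrite map_inj_uniq// => a b [].
- by move=> _ /mapP[a _ ->]; split.
Qed.

(** Induction on the word, one letter at a time: the increment splits at [g * a]. The part due to
    the letter [s] is a sum over the translated list [g * B], still without repetition, so the full
    energy bounds it; each letter costs a factor [2 ^ r * 2]. *)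
Lemma translate_word (w B : seq L) : {subset w <= S} -> uniq B -> 0 <= D ->
  \sum_(a <- B) `|f ((\big[*%g/1%g]_(x <- w) x) * a)%g - f a| `^ r
    <= (2 `^ r * 2) ^+ size w * D.
Proof.
move=> + uB D0; elim: w => [_|s w IH sw].
  rewrite big1 ?expr0 ?mul1r// => a _.
  by rewrite big_nil mul1g subrr normr0 powR0.
have sS : s \in S by apply: sw; rewrite mem_head.
have {}IH := IH (fun x xw => sw x (mem_behead (s := s :: w) xw)).
rewrite big_cons /=; set g := (\big[_/_]_(x <- w) x)%g in IH *.
have q1 : 1 <= 2 `^ r * 2 :> R.
  rewrite -[leLHS]mulr1 ler_pM// ?ler1n//.
  by rewrite -[leLHS](powRr0 2) ler_powR ?ler1n.
apply: (@le_trans _ _ (2 `^ r * (D + (2 `^ r * 2) ^+ size w * D))).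
  apply: (@le_trans _ _ (\sum_(a <- B) 2 `^ r *
      (`|f (s * (g * a))%g - f (g * a)%g| `^ r + `|f (g * a)%g - f a| `^ r))).
    apply: ler_sum => a _; rewrite -mulgA.
    by rewrite -(subrKA (f (g * a)%g)) powR_normD.
  rewrite -mulr_sumr big_split/= ler_wpM2l ?powR_ge0// lerD//.
  rewrite -(big_map (fun a => g * a)%g xpredT (fun a => `|f (s * a)%g - f a| `^ r)).
  by apply: translate_gen; rewrite // map_inj_uniq//; exact: mulgI.
rewrite exprS -!mulrA ler_wpM2l ?powR_ge0// mulr_natl mulr2n lerD2r.
by rewrite ler_peMl// exprn_ege1.
Qed.

End Translates.

Section Truncation.
Variables (G : groupType) (S : symGenSet G) (K : {fset G}) (f : G -> R).
Hypothesis fK : forall s y, s \in genset S -> y \in K -> (s * y)%g \notin K ->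
  f (s * y)%g = 0.

Let trunc y : R := (y \in K)%:R * f y.

Lemma mass_trunc : mass trunc = (\sum_(y <- K) `|f y| `^ r)%:E.
Proof.
rewrite /mass (@esum_supp _ _ K) => [||y yK].
- congr EFin; rewrite !big_seq; apply: eq_bigr => y yK.
  by rewrite /trunc yK mul1r.
- by move=> y; exact: powR_ge0.
- by rewrite /trunc (negbTE yK) mul0r normr0 powR0.
Qed.

(** An edge carrying gradient of [trunc] has an end in [K], and since [f] vanishes on the outer
    boundary of [K] its gradient there equals that of [f]. Edges starting in [K] are counted by [H],
    those ending in [K] by [H] after [flip]. *)
Lemma energy_trunc : (energy S trunc <=
  (2 * \sum_(y <- K) \sum_(s <- genset S) `|f (s * y)%g - f y| `^ r)%:E)%E.
Proof.
pose d (sy : G * G) : R := `|f (sy.1 * sy.2)%g - f sy.2| `^ r.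
pose H (sy : G * G) : R := (sy.2 \in K)%:R * d sy.
pose flip (sy : G * G) := (sy.1^-1, sy.1 * sy.2)%g.
have d0 sy : 0 <= d sy by exact: powR_ge0.
have H0 sy : 0 <= H sy by rewrite mulr_ge0.
have flipK : involutive flip by case=> s y; rewrite /flip /= invgK mulKg.
(* Reversing edges is an involution of the index set because the generating set is symmetric, so
   both sums are equal; this is the factor 2. *)
have -> : (2 * \sum_(y <- K) \sum_(s <- genset S) `|f (s * y)%g - f y| `^ r)%:E =
    (\esum_(sy in [set` genset S] `*` [set: G]) (H sy)%:E +
     \esum_(sy in [set` genset S] `*` [set: G]) (H (flip sy))%:E)%E.
  rewrite -(@reindex_esum _ _ _ ([set` genset S] `*` [set: G])
     ([set` genset S] `*` [set: G]) flip (fun sy => (H sy)%:E)); last first.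
    split=> [[s y] [/= sS _]|? ? _ _ /(inv_inj flipK)//|[s y] [/= sS _]].
      by split=> //=; exact: genset_sym.
    by exists (flip (s, y)); [split=> //=; exact: genset_sym|exact: flipK].
  have -> : (\esum_(sy in [set` genset S] `*` [set: G]) (H sy)%:E =
      \esum_(sy in [set` genset S] `*`` (fun=> [set: G])) (H (sy.1, sy.2))%:E)%E.
    by congr esum; apply/funext => -[].
  rewrite -(esum_esum (a := fun s y => (H (s, y))%:E)); last first.
    by move=> s y _ _; rewrite lee_fin.
  under eq_esum => s _.
    rewrite (@esum_supp _ (fun y => H (s, y)) K) => [||y yK]; last 2 first.
    - by [].
    - by rewrite /H (negbTE yK) mul0r.
    over.
  rewrite esum_fset//; last by move=> s _; rewrite lee_fin sumr_ge0.
  rewrite -fsbig_seq ?fset_uniq// sumEFin -EFinD -mulr2n mulr_natl; congr (_ *+ 2)%:E.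
  rewrite exchange_big; apply: eq_bigr => s _; rewrite !big_seq.
  by apply: eq_bigr => y yK; rewrite /H yK mul1r.
rewrite -esumD; [|by move=> *; rewrite lee_fin..].
apply: le_esum => -[s y] [/= sS _]; rewrite -EFinD lee_fin /trunc.
rewrite /H /d /flip/= mulKg [X in _ + _ * X](_ : _ = `|f (s * y)%g - f y| `^ r); last first.
  by rewrite distrC.
have [yK|yK] := boolP (y \in K); have [syK|syK] := boolP ((s * y)%g \in K).
- by rewrite !mul1r lerDl powR_ge0.
- by rewrite (fK sS yK syK) mulr0 !mul1r mul0r addr0.
- have := fK (genset_sym sS) syK; rewrite mulKg => /(_ yK) ->.
  by rewrite mulr0 !mul1r mul0r add0r.
- by rewrite !mul0r subrr normr0 powR0// addr0.
Qed.

End Truncation.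

End PowerEnergy.

(** * Mass against energy for finite exponents *)

Lemma component_avg_le (R : realType) (G L : groupType) (S : symGenSet G)
    (Z : L -> {fset G}) (e : L -> G -> R) (c : R) l x :
  (forall l y, `|e l y| <= c) -> `|component_avg S Z e l x| <= c.
Proof.
move=> ec; have c0 : 0 <= c := le_trans (normr_ge0 _) (ec l x).
rewrite normrM normfV normr_nat; set K := component S (Z l) x.
have [->|K0] := eqVneq #|` K| 0%N; first by rewrite invr0 mul0r.
rewrite ler_pdivrMl ?ltr0n ?lt0n//.
apply: le_trans (ler_norm_sum _ _ _) _.
apply: (@le_trans _ _ (\sum_(y <- K) c)); first by apply: ler_sum => y _.
by rewrite big_const_seq count_predT iter_addr_0 mulr_natl.
Qed.

(* Cutting [psi l] along the components of its support costs nothing: the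
   gradient of each piece is the gradient of [psi l] near that component. *)
Lemma mass_energy_transfer (R : realType) (r : R) (r1 : 1 <= r)
    (G L : groupType) (m : (G -> R) -> R) (mP : invariant_mean m)
    (SG : symGenSet G) (SL : {fset L}) (u : G -> L) (k : nat)
    (uk : forall s x : G, s \in genset SG -> exists w : seq L,
      [/\ {subset w <= SL}, (size w <= k)%N &
          u (s * x)%g = ((\big[*%g/1%g]_(y <- w) y) * u x)%g])
    (f : L -> R) (A : {fset L}) (fA : forall l, l \notin A -> f l = 0)
    (Z : L -> {fset G}) (M : nat)
    (ZE : forall l x, (x \in Z l) = ((u x * l)%g \in A))
    (ZM : forall l, (#|` Z l| <= M)%N)
    (J : R) (J0 : 0 <= J)
    (HG : forall (h : G -> R) (K : {fset G}) (D : R),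
       (forall x, x \notin K -> h x = 0) -> (#|` K| <= M)%N -> 0 <= D ->
       (energy r SG h <= D%:E)%E -> (mass r h <= (J * D)%:E)%E)
    (D : R) (D0 : 0 <= D) (fD : (energy r SL f <= D%:E)%E) :
  (mass r f <= (2 * #|` genset SG|%:R * (2 `^ r * 2) ^+ k * J * D)%:E)%E.
Proof.
have rN0 : r != 0 by rewrite gt_eqF// (lt_le_trans _ r1).
have r0 : 0 <= r by exact: le_trans r1.
pose psi (l : L) (y : G) : R := f (u y * l)%g.
pose e1 (l : L) (y : G) : R := `|psi l y| `^ r.
pose e2 (l : L) (y : G) : R := \sum_(s <- genset SG) `|psi l (s * y)%g - psi l y| `^ r.
pose c0 : R := \sum_(a <- A) `|f a|.
have fc l : `|f l| <= c0.
  have [lA|/fA ->] := boolP (l \in A); last by rewrite normr0 sumr_ge0.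
  by rewrite /c0 (big_fsetD1 l)//= lerDl sumr_ge0.
have c00 : 0 <= c0 by exact: sumr_ge0.
have fc' l : `|f l| `^ r <= c0 `^ r by rewrite ge0_ler_powR ?nnegrE.
have e1c l y : `|e1 l y| <= c0 `^ r by rewrite ger0_norm; [exact: fc'|exact: powR_ge0].
have e2c l y : `|e2 l y| <= \sum_(s <- genset SG) 2 `^ r * (c0 `^ r + c0 `^ r).
  rewrite ger0_norm; last by rewrite sumr_ge0// => *; exact: powR_ge0.
  apply: ler_sum => s _; apply: le_trans (powR_normD r1 _ _) _.
  by rewrite normrN ler_wpM2l ?powR_ge0 ?lerD ?fc'.
have bavg (e : L -> G -> R) (c : R) : (forall l y, `|e l y| <= c) ->
    bounded_fun (fun x => \sum_(a <- A) component_avg SG Z e ((u x)^-1 * a)%g x).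
  move=> ec; apply: (@bounded_funI _ _ (\sum_(a <- A) c)) => x.
  apply: le_trans (ler_norm_sum _ _ _) _; apply: ler_sum => a _.
  exact: component_avg_le.
(* The inequality on [G] is applied to [psi l] cut off to one component [K]; its size is at most
   [M], and the weight [1/#|K|] is the same on both sides. *)
have avg_le l x : component_avg SG Z e1 l x <= 2 * J * component_avg SG Z e2 l x.
  rewrite /component_avg mulrCA ler_wpM2l ?invr_ge0//.
  set K := component SG (Z l) x.
  have psiK s y : s \in genset SG -> y \in K -> (s * y)%g \notin K ->
      psi l (s * y)%g = 0.
    move=> sS yK sK; apply: fA; rewrite -ZE; apply: contra sK.
    exact: component_step.
  rewrite -lee_fin -(mass_trunc r1 K (psi l)) -mulrA mulrCA.
  apply: (HG _ K).
  - by move=> y yK; rewrite (negbTE yK) mul0r.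
  - apply: leq_trans (ZM l); apply: fsubset_leq_card.
    by apply/fsubsetP => y; exact: component_sub.
  - by rewrite mulr_ge0// sumr_ge0// => y _; rewrite sumr_ge0// => *; exact: powR_ge0.
  - exact: energy_trunc.
rewrite /mass (@esum_supp _ _ _ A) => [|l|l /fA ->]; [|exact: powR_ge0|by rewrite normr0 powR0].
rewrite lee_fin.
(* After transport the integrand at [y] uses [l = (u y)^-1 * a], where [psi l y = f a]. It is
   constant in [y], so the mean returns the mass of [f] exactly. *)
have -> : \sum_(a <- A) `|f a| `^ r =
    m (fun x => \sum_(a <- A) component_avg SG Z e1 ((u x)^-1 * a)%g x).
  rewrite (component_transport mP SG ZE ZM e1c) -[LHS](mean_cst mP); congr m.
  by apply/funext => y; apply: eq_bigr => a _; rewrite /e1 /psi mulVKg.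
apply: (@le_trans _ _ (2 * J *
    m (fun x => \sum_(a <- A) component_avg SG Z e2 ((u x)^-1 * a)%g x))).
  rewrite -(meanZ mP)//; last exact: bavg e2c.
  apply: (mean_le mP).
  - exact: bavg e1c.
  - have [c cP] := bounded_funE (bavg _ _ e2c).
    apply: (@bounded_funI _ _ (2 * J * c)) => x.
    by rewrite normrM ger0_norm ?mulr_ge0// ler_wpM2l ?mulr_ge0.
  - by move=> x; rewrite mulr_sumr; apply: ler_sum => a _; exact: avg_le.
have -> : 2 * #|` genset SG|%:R * (2 `^ r * 2) ^+ k * J * D =
    2 * J * (#|` genset SG|%:R * ((2 `^ r * 2) ^+ k * D)).
  rewrite -!mulrA; congr (_ * _); rewrite [RHS]mulrCA; congr (_ * _).
  exact: mulrCA.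
rewrite ler_wpM2l ?mulr_ge0// (component_transport mP SG ZE ZM e2c).
rewrite -[leRHS](mean_cst mP); apply: (mean_le mP).
- apply: (@bounded_funI _ _ (\sum_(a <- A)
    \sum_(s <- genset SG) 2 `^ r * (c0 `^ r + c0 `^ r))) => x.
  by apply: le_trans (ler_norm_sum _ _ _) _; apply: ler_sum => a _.
- exact: bounded_fun_cst.
(* For the same [l], [psi l (s * y)] is [f] at [a] multiplied on the left by a word of length at
   most [k], so each generator contributes at most the bound of [translate_word]. *)
- move=> y; rewrite exchange_big/= big_seq.
  apply: (@le_trans _ _ (\sum_(s <- genset SG) (2 `^ r * 2) ^+ k * D)); last first.
    by rewrite big_const_seq count_predT iter_addr_0 mulr_natl.
  rewrite [leRHS]big_seq; apply: ler_sum => s sS.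
  have [w [wS wk us]] := uk s y sS.
  apply: (@le_trans _ _ ((2 `^ r * 2) ^+ size w * D)); last first.
    rewrite ler_wpM2r// ler_weXn2l//.
    rewrite -[leLHS]mulr1 ler_pM// ?ler1n//.
    by rewrite -[leLHS](powRr0 2) ler_powR ?ler1n.
  have := translate_word r1 fD wS (fset_uniq A) D0.
  congr (_ <= _); apply: eq_bigr => a _.
  by rewrite /psi us -mulgA mulVKg.
Qed.

(** * Word lengths and level sets of regular maps *)

Lemma word_length_spelled (G : groupType) (S : symGenSet G) (g : G) :
  exists2 w, spelled S g w & size w = word_length S g.
Proof. by rewrite /word_length; case: ex_minnP => n /asboolP. Qed.

Lemma word_length_gen (G : groupType) (S : symGenSet G) (s : G) :
  s \in genset S -> (word_length S s <= 1)%N.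
Proof.
move=> sS; rewrite /word_length; case: ex_minnP => n _; apply; apply/asboolP.
exists [:: s] => //; split; last by rewrite big_seq1.
by move=> x; rewrite inE => /eqP ->.
Qed.

Lemma fset_preimage (T U : choiceType) (f : T -> U) (N : nat) :
  (forall y, (f @^-1` [set y] #<= `I_N)%card) ->
  forall B : {fset U}, exists2 Z : {fset T},
    forall x, (x \in Z) = (f x \in B) & (#|` Z| <= N * #|` B|)%N.
Proof.
move=> fN B.
have finf y : finite_set (f @^-1` [set y]).
  exact: card_le_finite (fN y) (finite_II N).
have finB : finite_set (f @^-1` [set` B]).
  rewrite (_ : _ @^-1` _ = \bigcup_(y in [set` B]) f @^-1` [set y]).
    exact: bigcup_finite.
  by apply/seteqP; split=> [x fx|x [y /= yB ->//]]; exists (f x).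
have ZE x : (x \in fset_set (f @^-1` [set` B])) = (f x \in B).
  by rewrite in_fset_set//; apply/idP/idP; rewrite inE.
exists (fset_set (f @^-1` [set` B])) => //; set Z := fset_set _ in ZE *.
(* Double counting of the pairs with [f x = y], at most [N] for each [y]. *)
have -> : #|` Z| = (\sum_(x <- Z) \sum_(y <- B) (f x == y))%N.
  rewrite card_fset_sum1 !big_seq; apply: eq_bigr => x.
  rewrite ZE => fxB; rewrite (big_fsetD1 (f x))//= eqxx.
  rewrite big_seq big1 ?addn0// => y; rewrite in_fsetD1 => /andP[/negPf].
  by rewrite eq_sym => ->.
rewrite exchange_big/=.
apply: (@leq_trans (\sum_(y <- B) N)).
  apply: leq_sum => y _; apply: leq_trans (geq_card_fset_set (fN y)).
  rewrite (_ : \sum_(x <- Z) _ = size [seq x <- Z | f x == y]); last first.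
    by rewrite size_filter -sum1_count [RHS]big_mkcond; apply: eq_bigr => x _; case: eqP.
  apply: uniq_leq_size; first by rewrite filter_uniq// fset_uniq.
  by move=> x; rewrite mem_filter => /andP[/eqP fx _]; rewrite in_fset_set// inE.
by rewrite big_const_seq count_predT iter_addn_0.
Qed.

(* The profile uses the left gradient while the word metric is left-invariant,
   hence the two inversions in [(f x^-1)^-1]. *)
Lemma regular_twist (R : realType) (G L : groupType) (SG : symGenSet G)
    (SL : symGenSet L) (f : G -> L) : regular R SG SL f ->
  exists u : G -> L, exists k N : nat,
    (forall s x : G, s \in genset SG -> exists w : seq L,
      [/\ {subset w <= genset SL}, (size w <= k)%N &
          u (s * x)%g = ((\big[*%g/1%g]_(y <- w) y) * u x)%g]) /\
    (forall A : {fset L}, exists2 Z : L -> {fset G},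
      forall l x, (x \in Z l) = ((u x * l)%g \in A) &
      forall l, (#|` Z l| <= N * #|` A|)%N).
Proof.
move=> [[K fK] [N fN]]; pose u (x : G) := ((f x^-1)^-1)%g.
(* An integer bound for the Lipschitz constant, whose sign is not prescribed. *)
exists u, (Num.truncn `|K|).+1, N; split=> [s x sS|A].
  have := fK (x^-1 * s^-1)%g (x^-1)%g; rewrite /word_dist.
  set g := (_^-1 * f _)%g; rewrite invgM !invgK mulgK.
  have [w [wS wg] <-] := word_length_spelled SL g.
  have s1 := word_length_gen sS; move=> wK.
  exists w; split=> //; last by rewrite wg /g /u invgM mulgK.
  rewrite -(ler_nat R); apply: le_trans wK _.
  apply: (@le_trans _ _ `|K|); last by apply/ltW; rewrite truncnS_gt.
  apply: (@le_trans _ _ (`|K| * (word_length SG s)%:R)).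
    by rewrite ler_wpM2r// ler_norm.
  by rewrite ler_piMr// lern1.
(* [u x * l] lies in [A] exactly when [f x^-1] lies in [l * A^-1], so the level set is the inverse
   of a preimage under [f]. *)
have Zl l : exists Z : {fset G}, (forall x, (x \in Z) = ((u x * l)%g \in A)) /\
    (#|` Z| <= N * #|` A|)%N.
  have [Z ZE ZN] := fset_preimage fN [fset (l * a^-1)%g | a in A]%fset.
  exists [fset (x^-1)%g | x in Z]%fset; split=> [x|].
    rewrite -[x in LHS]invgK mem_imfset /=; last exact: invg_inj.
    rewrite ZE; apply/imfsetP/idP => [[a /= aA]|xA].
      by rewrite /u => ->; rewrite invgM invgK mulgVK.
    by exists (u x * l)%g => //; rewrite /u invgM invgK mulVKg.
  apply: leq_trans (leq_trans ZN _).
    by rewrite leq_imfset_card.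
  by rewrite leq_mul2l leq_imfset_card orbT.
by have [Z ZP] := choice Zl; exists Z => l; have [] := ZP l.
Qed.

(** * Norms and profile ratios in the extended reals *)

Section GradientBounds.
Variable R : realType.
Local Open Scope ereal_scope.

(** Removes the division from the profile. For [e = 0] the ratio is finite only if [n = 0], which is
    what [d = 0] gives on the right; for [e = +oo] the ratio is 0 and no real [d] qualifies. *)
Lemma lee_div_fin (n e : \bar R) (j : R) : 0 <= n -> 0 <= e -> (0 <= j)%R ->
  n / e <= j%:E <-> forall d, (0 <= d)%R -> e <= d%:E -> n <= (j * d)%:E.
Proof.
move=> n0 e0 j0; split=> [nej d d0 ed|ned].
  case: e e0 ed nej => // e; rewrite !lee_fin => e0 ed.
  rewrite inver; case: eqP => [_|/eqP eN0].
    have [->|nN0] := eqVneq n 0; first by rewrite lee_fin mulr_ge0.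
    by rewrite gt0_muley ?lt_def ?nN0.
  have ep : (0 < e)%R by rewrite lt_def eN0.
  rewrite lee_pdivrMr// => /le_trans; apply.
  by rewrite -EFinM lee_fin ler_wpM2l.
case: e e0 ned => [e| |] //; last by rewrite invey mule0 lee_fin.
rewrite lee_fin => e0 /(_ e e0 (lexx _)) ne; rewrite inver.
case: eqP ne => [->|/eqP eN0 ne].
  rewrite mulr0 => nle; have -> : n = 0 by apply/le_anti; rewrite n0 nle.
  by rewrite mul0e lee_fin.
by rewrite lee_pdivrMr ?lt_def ?eN0// -EFinM.
Qed.

Lemma poweR_inv_le (x : \bar R) (r d : R) : (1 <= r)%R -> (0 <= d)%R -> 0 <= x ->
  (poweR x r^-1 <= d%:E) = (x <= (d `^ r)%:E).
Proof.
move=> r1 d0 x0; have rp : (0 < r)%R := lt_le_trans ltr01 r1.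
have rN0 : r != 0%R by rewrite gt_eqF.
apply/idP/idP => xd.
  rewrite -(poweRe1 x0) -(mulVf rN0) poweRrM -poweR_EFin.
  apply: (gt0_ler_poweR (ltW rp)) xd; rewrite in_itv/= ?poweR_ge0 ?lee_fin ?d0 ?leey//.
have -> : d%:E = poweR (d `^ r)%:E r^-1.
  by rewrite poweR_EFin -powRrM mulfV// powRr1.
apply: gt0_ler_poweR xd; rewrite ?invr_ge0 ?(ltW rp)// in_itv/= ?x0 ?leey//.
by rewrite lee_fin powR_ge0.
Qed.

Lemma lpnorm_ge0 (p : \bar R) (T : choiceType) (D : set T) (f : T -> R) :
  0 <= lpnorm p D f.
Proof.
case: p => [r| |] //=; first exact: poweR_ge0.
by apply: ereal_sup_ubound; left.
Qed.

Lemma lpnorm_fin_le (r : R) (T : choiceType) (D : set T) (f : T -> R) (d : R) :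
  (1 <= r)%R -> (0 <= d)%R ->
  (lpnorm r%:E D f <= d%:E) = (\esum_(x in D) (`|f x| `^ r)%:E <= (d `^ r)%:E).
Proof.
move=> r1 d0; rewrite /= poweR_inv_le//.
by apply: esum_ge0 => x _; rewrite lee_fin powR_ge0.
Qed.

Lemma lpnorm_oo_le (T : choiceType) (D : set T) (f : T -> R) (d : R) :
  (0 <= d)%R -> lpnorm +oo D f <= d%:E <-> forall x, D x -> (`|f x| <= d)%R.
Proof.
move=> d0; split=> [fd x Dx|fd].
  rewrite -lee_fin; apply: le_trans fd; apply: ereal_sup_ubound.
  by right; exists x.
apply: ge_ereal_sup => _ [->|[x Dx <-]]; first by rewrite lee_fin.
by rewrite lee_fin fd.
Qed.

Lemma lpnorm_cst0 (p : \bar R) (T : choiceType) (D : set T) : 1 <= p ->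
  lpnorm p D (fun=> 0%R : R) = 0.
Proof.
move=> p1; apply/le_anti; rewrite lpnorm_ge0 andbT.
case: p p1 => [r| |] //= p1.
  have r1 : (1 <= r)%R by rewrite -lee_fin.
  rewrite (@lpnorm_fin_le r)// esum1 ?lee_fin ?powR_ge0// => x _.
  by rewrite normr0 powR0// gt_eqF// (lt_le_trans _ r1).
by apply/(@lpnorm_oo_le _ _ _ 0) => // x _; rewrite normr0.
Qed.

(* For [j >= 0] this says that the ratio bounded by [profile] is at most [j],
   see [lee_div_fin]. *)
Definition sobolev (p : \bar R) (G : groupType) (S : {fset G}) (j : R)
    (f : G -> R) : Prop :=
  forall d, (0 <= d)%R -> grad_norm p S f <= d%:E ->
    lpnorm p [set: G] f <= (j * d)%:E.

(** * Transfer of Sobolev inequalities from [G] to [L] *)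

Section Transfer.
Variables (p : \bar R) (G L : groupType) (SG : symGenSet G) (SL : symGenSet L).
Variables (u : G -> L) (k : nat).
Hypothesis uk : forall s x : G, s \in genset SG -> exists w : seq L,
  [/\ {subset w <= genset SL}, (size w <= k)%N &
      u (s * x)%g = ((\big[*%g/1%g]_(y <- w) y) * u x)%g].
Variables (f : L -> R) (A : {fset L}) (Z : L -> {fset G}) (M : nat).
Hypothesis fA : forall l, l \notin A -> f l = 0%R.
Hypothesis ZE : forall l x, (x \in Z l) = ((u x * l)%g \in A).
Hypothesis ZM : forall l, (#|` Z l| <= M)%N.
Variable j : R.
Hypothesis j0 : (0 <= j)%R.
Hypothesis HG : forall (h : G -> R) (K : {fset G}),
  (forall x, x \notin K -> h x = 0%R) -> (#|` K| <= M)%N -> sobolev p SG j h.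

(** The r-th root of [mass_energy_transfer] with [J = j ^ r]. The successor on the number of
    generators keeps the constant positive even for an empty generating set. *)
Lemma sobolev_transfer_fin (r : R) : (1 <= r)%R -> p = r%:E -> amenable R G ->
  sobolev p SL (((2 * #|` genset SG|.+1%:R * (2 `^ r * 2) ^+ k) `^ r^-1)%R * j) f.
Proof.
move=> r1 pr [m mP] d d0 fd.
have rp : (0 < r)%R := lt_le_trans ltr01 r1.
have rN0 : r != 0%R by rewrite gt_eqF.
have rK (x : R) : (0 <= x)%R -> ((x `^ r^-1) `^ r = x)%R.
  by move=> x0; rewrite -powRrM mulVf// powRr1.
set C := (2 * _ * _)%R; have C0 : (0 <= C)%R.
  by rewrite !mulr_ge0// exprn_ge0// mulr_ge0// powR_ge0.
move: fd; rewrite pr /grad_norm !lpnorm_fin_le// ?mulr_ge0 ?powR_ge0// => fd.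
rewrite powRM ?mulr_ge0 ?powR_ge0// powRM ?powR_ge0// rK//.
apply: le_trans (mass_energy_transfer r1 mP uk fA ZE ZM (powR_ge0 j r) _
  (powR_ge0 d r) fd) _.
  move=> h K D hK KM D0 hD.
  (* An energy bound [D] is a gradient norm bound by the r-th root of [D]. *)
  have := HG hK KM (powR_ge0 D r^-1); rewrite pr /grad_norm !lpnorm_fin_le// ?powR_ge0//.
    by rewrite powRM// ?powR_ge0// rK//; exact.
  by rewrite mulr_ge0 ?powR_ge0.
rewrite lee_fin ler_wpM2r ?powR_ge0// ler_wpM2r ?powR_ge0// /C.
rewrite ler_wpM2r ?exprn_ge0 ?mulr_ge0 ?powR_ge0//.
by rewrite ler_wpM2l// ler_nat.
Qed.

(** The pull-back takes the value [f a] at 1, and telescoping along words of length at most [k]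
    bounds its gradient by [k * d]. *)
Lemma sobolev_transfer_oo : p = +oo -> sobolev p SL (j * k%:R)%R f.
Proof.
move=> poo d d0; rewrite poo /grad_norm lpnorm_oo_le// => fd.
have fw (w : seq L) a : {subset w <= genset SL} ->
    (`|f ((\big[*%g/1%g]_(y <- w) y) * a)%g - f a| <= (size w)%:R * d)%R.
  elim: w => [_|s w IH sw]; first by rewrite big_nil mul1g subrr normr0 mul0r.
  have {}IH := IH (fun x xw => sw x (mem_behead (s := s :: w) xw)).
  rewrite big_cons -mulgA; set g := (_ * a)%g in IH *.
  rewrite -(subrKA (f g)) (le_trans (ler_normD _ _))//.
  rewrite [size _]/= -natr1 mulrDl mul1r addrC lerD//.
  by apply: (fd (s, g)); split=> //=; apply: sw; rewrite mem_head.
apply/lpnorm_oo_le; rewrite ?mulr_ge0// => a _.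
pose l := ((u 1)^-1 * a)%g.
have := HG (h := fun x => f (u x * l)%g) (K := Z l).
have hK x : x \notin Z l -> f (u x * l)%g = 0%R by rewrite ZE => /fA.
have kd : (0 <= k%:R * d)%R by rewrite mulr_ge0.
move=> /(_ hK (ZM l) _ kd); rewrite poo /grad_norm !lpnorm_oo_le// ?mulr_ge0//.
move=> H; rewrite -mulrA; have := H _ 1%g I; rewrite /l mulVKg; apply.
move=> [s y] [/= sS _]; have [w [wS wk ->]] := uk y sS.
rewrite -mulgA (le_trans (fw _ _ wS))// ler_wpM2r//.
by rewrite ler_nat.
Qed.

End Transfer.

End GradientBounds.

(** * Comparison of the two profiles *)

Theorem theorem3 (R : realType) (p : \bar R) (hp : (1 <= p)%E)
    (G L : groupType) (SG : symGenSet G) (SL : symGenSet L)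
    (amG : amenable R G) (amL : amenable R L)
    (hreg : exists f : G -> L, regular R SG SL f) :
  dominates (profile p SG) (profile p SL).
Proof.
case: hreg => _ /regular_twist[u [k [N [uk uZ]]]].
(* One positive constant, chosen before the test function, covers finite and infinite [p] alike. *)
have [c c0 transfer] : exists2 c : R, 0 < c &
    forall (f : L -> R) (A : {fset L}) (Z : L -> {fset G}) (M : nat),
    (forall l, l \notin A -> f l = 0) ->
    (forall l x, (x \in Z l) = ((u x * l)%g \in A)) ->
    (forall l, (#|` Z l| <= M)%N) ->
    forall j, 0 <= j ->
    (forall (h : G -> R) (K : {fset G}), (forall x, x \notin K -> h x = 0) ->
       (#|` K| <= M)%N -> sobolev p SG j h) ->
    sobolev p SL (c * j) f.
  case: p hp => [r| |] // r1.
    rewrite lee_fin in r1.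
    exists ((2 * #|` genset SG|.+1%:R * (2 `^ r * 2) ^+ k) `^ r^-1).
      by rewrite powR_gt0// !mulr_gt0 ?exprn_gt0 ?mulr_gt0 ?powR_gt0 ?ltr0n.
    move=> f A Z M fA ZE ZM j j0 HG.
    exact: (sobolev_transfer_fin uk fA ZE ZM j0 HG r1 erefl amG).
  exists k.+1%:R => [|f A Z M fA ZE ZM j j0 HG d d0 fd]; first by rewrite ltr0n.
  apply: le_trans (sobolev_transfer_oo uk fA ZE ZM j0 HG erefl d0 fd) _.
  by rewrite lee_fin ler_wpM2r// mulrC ler_wpM2r// ler_nat.
(* Level sets have at most [N * n] points; the successor makes the dilation factor positive. *)
exists N.+1%:R; first by rewrite ltr0n.
exists c => //; apply: nearW => n; apply: ge_ereal_sup => _ [f [f0 finf fn] <-].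
set A := fset_set (supp f) in fn.
have fA l : l \notin A -> f l = 0.
  by rewrite in_fset_set// => /negP lf; apply/eqP/negPn/negP => fl; apply: lf; rewrite inE.
have [Z ZE ZN] := uZ A.
have ZM l : (#|` Z l| <= N * #|` A|)%N by [].
set P := profile p SG _.
have ratioP (h : G -> R) (K : {fset G}) : (forall x, x \notin K -> h x = 0) ->
    (#|` K| <= N * #|` A|)%N -> h <> (fun=> 0) ->
    (lpnorm p [set: G] h / grad_norm p SG h <= P)%E.
  move=> hK KM h0; apply: ereal_sup_ubound; exists h => //.
  have hs : supp h `<=` [set` K].
    by move=> x /= hx; apply: contraNT hx => /hK ->.
  have finh : finite_set (supp h) by exact: sub_finite_set hs (finite_fset K).
  split=> //; rewrite -natrM ler_nat; rewrite ler_nat in fn.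
  apply: (@leq_trans #|` K|).
    by apply: fsubset_leq_card; apply/fsubsetP => x; rewrite in_fset_set// inE; exact: hs.
  by apply: leq_trans KM _; rewrite leq_mul.
(* A supremum over no competitor would be [-oo]; a pull-back with the nonzero value [f a] at 1 is a
   competitor. *)
have P0 : (0 <= P)%E.
  have [a fa] : exists a, f a != 0.
    apply: contrapT => fz; apply: f0; apply/funext => a.
    by apply/eqP/negPn/negP => fa; apply: fz; exists a.
  pose l := ((u 1)^-1 * a)%g.
  apply: le_trans (ratioP (fun x => f (u x * l)%g) (Z l) _ _ _).
  - by rewrite mule_ge0 ?inve_ge0 ?lpnorm_ge0.
  - by move=> x; rewrite ZE => /fA.
  - exact: ZM.
  - move/(congr1 (fun h => h 1%g)); rewrite /l mulVKg => fa0.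
    by rewrite fa0 eqxx in fa.
case EP : P P0 ratioP => [j| |] // j0 ratioP; last by rewrite gt0_muley ?lte_fin// leey.
rewrite -EFinM; rewrite lee_fin in j0.
apply/lee_div_fin; rewrite ?lpnorm_ge0 ?mulr_ge0 ?(ltW c0)//.
apply: (transfer f A Z _ fA ZE ZM j j0) => h K hK KM.
(* The profile says nothing about the zero function, for which the inequality is immediate. *)
have [->|h0] := pselect (h = fun=> 0).
  by move=> d d0 _; rewrite lpnorm_cst0// lee_fin mulr_ge0.
by apply/(lee_div_fin _ _ j0); rewrite ?lpnorm_ge0//; exact: (ratioP h K).
Qed.
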